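(* Let $a,b\in\mathbb{R}$ with $a<b$, and let $P$ be the uniform distribution on the line segment (closed interval) $[a,b]\subset\mathbb{R}$. Then: (i) for every integer $n\ge 2$, the conditional optimal set of $n$-points for $P$ with respect to the conditional set $\beta:=\{a,b\}$ is $$\Big\{a+\frac{j-1}{n-1}(b-a) : 1\le j\le n\Big\}$$ with conditional quantization error $V_n=\frac{(b-a)^2}{12(n-1)^2}$; (ii) for every integer $n\ge 1$, the conditional optimal set of $n$-points for $P$ with respect to the conditional set $\beta:=\{a\}$ is $$\Big\{a+\frac{2(j-1)(b-a)}{2n-1} : 1\le j\le n\Big\}$$ with conditional quantization error $V_n=\frac{(b-a)^2}{3(2n-1)^2}$; (iii) for every integer $n\ge 1$, the conditional optimal set of $n$-points for $P$ with respect to the conditional set $\beta:=\{b\}$ is $$\Big\{a+\frac{(2j-1)(b-a)}{2n-1} : 1\le j\le n\Big\}$$ with conditional quantization error $V_n=\frac{(b-a)^2}{3(2n-1)^2}$.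
   Context: The uniform distribution on $[a,b]$ has density $\frac{1}{b-a}$ on $[a,b]$ and $0$ elsewhere. Let $P$ be a Borel probability measure on $\mathbb{R}$ with finite second moment, let $\beta\subset\mathbb{R}$ be a finite set with $\mathrm{card}(\beta)=\ell\ge1$, and let $n\ge\ell$ be an integer. The $n$th conditional (unconstrained) quantization error for $P$ with respect to the conditional set $\beta$ is $$V_n=V_n(P)=\inf_{\alpha}\Big\{\int\min_{c\in\alpha\cup\beta}|x-c|^2\,dP(x) : \alpha\subseteq\mathbb{R},\ 0\le\mathrm{card}(\alpha)\le n-\ell\Big\}.$$ For a finite set $\gamma$ and $c\in\gamma$, the Voronoi region $M(c|\gamma)$ is the set of all $x$ with $|x-c|=\min_{c'\in\gamma}|x-c'|$. A conditional (unconstrained) optimal set of $n$-points for $P$ with respect to $\beta$ is a set $\alpha\cup\beta$, with $\alpha$ as in the infimum, which attains the infimum, satisfies $P(M(c|\alpha\cup\beta))>0$ for every $c\in\beta$, and contains at least $\ell$ and at most $n$ elements. *)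

(* Defs.v *)
From HB Require Import structures.
From mathcomp Require Import all_boot all_order all_algebra.
From mathcomp Require Import finmap.
From mathcomp Require Import all_classical all_reals all_analysis.

Set Implicit Arguments.
Unset Strict Implicit.
Unset Printing Implicit Defensive.

Import Order.TTheory GRing.Theory Num.Theory.
Import numFieldNormedType.Exports.

Local Open Scope classical_set_scope.
Local Open Scope ring_scope.

Section conditional_quantization.
Context {R : realType}.
Implicit Types (P : probability (measurableTypeR R) R) (alpha beta gamma : {fset R}).

(* A minimum over a finite set, taken in [\bar R] so that it is also defined
   (as +oo) on the empty set; below it is only relevant for nonempty sets,
   since the conditional set is nonempty. *)
Definition fmin gamma (f : R -> R) : \bar R :=
  \big[Order.min/+oo%E]_(c <- gamma) (f c)%:E.

Definition distortion P gamma : \bar R :=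
  (\int[P]_x fmin gamma (fun c => (`|x - c| ^+ 2)%R))%E.

(* Meaningful for [#|` beta| <= n]: the subtraction on [nat] is truncated. *)
Definition cond_quant_error P beta (n : nat) : \bar R :=
  ereal_inf [set distortion P (alpha `|` beta)%fset |
             alpha in [set alpha | (#|` alpha| <= n - #|` beta|)%N]].

Definition voronoi (c : R) gamma : set R :=
  [set x | (`|x - c|)%:E = fmin gamma (fun c' => `|x - c'|)].

Definition cond_optimal P beta (n : nat) gamma : Prop :=
  exists alpha : {fset R},
    [/\ (#|` alpha| <= n - #|` beta|)%N /\ gamma = (alpha `|` beta)%fset,
        distortion P gamma = cond_quant_error P beta n,
        (forall c, c \in beta -> (0 < P (voronoi c gamma))%E) &
        (#|` beta| <= #|` gamma| <= n)%N].

End conditional_quantization.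

(* Main.v *)
(** Put [l = #|beta|] and [r = (b - a) / (2 n - l)], and let
    [T_c x = max (0, r^2 - (x - c)^2)].  Pointwise on [[a, b]],
    [d (x, gamma)^2 >= r^2 - \sum_(c in gamma) T_c x], since a single tent, that
    of a nearest point, already makes up for the difference.  The integral of
    [T_c] over [[a, b]] is at most [4 r^3 / 3], and equals [2 r^3 / 3] when [c]
    is an endpoint, so integrating over [[a, b]] bounds the distortion of every
    admissible [gamma] below by [r^2 / 3], without ordering its points.  Equality
    forces the (continuous, nonnegative) defect to vanish everywhere: every [x]
    in [[a, b]] is within [r] of [gamma], and at most one point of [gamma] is
    at distance less than [r] from [x].  Starting from a prescribed endpoint,
    these two properties produce the points of the grid of mesh [2 r] one after
    another. *)

Require Import Defs.
From HB Require Import structures.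
From mathcomp Require Import all_boot all_order all_algebra.
From mathcomp Require Import finmap.
From mathcomp Require Import all_classical all_reals all_analysis.
From mathcomp Require Import measurable_realfun ring lra.

Set Implicit Arguments.
Unset Strict Implicit.
Unset Printing Implicit Defensive.

Import Order.TTheory GRing.Theory Num.Theory.
Import numFieldNormedType.Exports.

Local Open Scope classical_set_scope.
Local Open Scope ring_scope.

(** * Integrals of continuous functions over a segment *)

Section analysis.
Context {R : realType}.
Local Notation mu := (@lebesgue_measure R).
Implicit Types (a b c p q r x : R) (f : R -> R).

Lemma continuous_segment_integrable a b f :
  continuous f -> mu.-integrable `[a, b] (EFin \o f).
Proof.
move=> cf; apply: continuous_compact_integrable; first exact: segment_compact.
exact: continuous_subspaceT.
Qed.

Lemma Rintegral_segment_cst a b k : a <= b ->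
  \int[mu]_(x in `[a, b]) k = k * (b - a).
Proof.
move=> ab; rewrite Rintegral_cst//; congr (_ * _).
have := lebesgue_measure_itv `[a, b]; rewrite /= lte_fin => ->.
by case: ltgtP ab => // -> _; rewrite subrr.
Qed.

Lemma continuous_sumr (I : Type) (s : seq I) (F : I -> R -> R) :
  (forall i, continuous (F i)) -> continuous (fun x => \sum_(i <- s) F i x).
Proof.
move=> cF; elim: s => [|i s IH] x.
  by under eq_fun do rewrite big_nil; exact: cvg_cst.
under eq_fun do rewrite big_cons.
by apply: cvgD; [exact: cF|exact: IH].
Qed.

Lemma Rintegral_segment_sum (I : eqType) (s : seq I) a b (F : I -> R -> R) :
  (forall i, continuous (F i)) ->
  \int[mu]_(x in `[a, b]) (\sum_(i <- s) F i x) =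
  \sum_(i <- s) \int[mu]_(x in `[a, b]) F i x.
Proof.
move=> cF; elim: s => [|i s IH].
  under eq_Rintegral do rewrite big_nil.
  by rewrite big_nil Rintegral_cst// mul0r.
under eq_Rintegral do rewrite big_cons.
rewrite big_cons RintegralD ?IH//; apply: continuous_segment_integrable => //.
exact: continuous_sumr.
Qed.

Lemma ge0_subset_Rintegral (A B : set (measurableTypeR R)) f :
  measurable A -> measurable B ->
  mu.-integrable B (EFin \o f) -> A `<=` B -> (forall x, B x -> 0 <= f x) ->
  \int[mu]_(x in A) f x <= \int[mu]_(x in B) f x.
Proof.
move=> mA mB fB AB f0.
rewrite fine_le//; first exact/(integrable_fin_num mA)/(integrableS mB).
  exact: integrable_fin_num.
by apply: ge0_subset_integral => //; case/integrableP: fB.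
Qed.

(** A positive value [f x0] persists, up to a factor 2, on a nondegenerate subsegment, and this
    alone makes the integral positive. *)
Lemma continuous_Rintegral0_eq0 a b f : a < b -> continuous f ->
  (forall x, x \in `[a, b] -> 0 <= f x) -> \int[mu]_(x in `[a, b]) f x <= 0 ->
  forall x, x \in `[a, b] -> f x = 0.
Proof.
move=> ab cf f0 If x0 x0ab; apply/eqP; rewrite eq_le f0// andbT leNgt.
apply/negP => fx0.
have fx02 : 0 < f x0 / 2 by rewrite divr_gt0.
have /cvgrPdist_lt/(_ _ fx02)[/= d d0 fd] := cf x0.
(* Halving [d] keeps the closed segment inside the open ball given by continuity; truncating at [a]
   and [b] makes it one-sided when [x0] is an endpoint. *)
pose p := Num.max a (x0 - d / 2); pose q := Num.min b (x0 + d / 2).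
move: (x0ab); rewrite in_itv/= => /andP[ax0 x0b].
have pq : p < q by rewrite /p /q lt_min !gt_max; lra.
suff : 0 < \int[mu]_(x in `[a, b]) f x by rewrite ltNge If.
have pqab : `[p, q] `<=` `[a, b].
  move=> x /=; rewrite !in_itv/= /p /q ge_max le_min; lra.
apply: (@lt_le_trans _ _ (\int[mu]_(x in `[p, q]) f x)); last first.
  by apply: ge0_subset_Rintegral => //; exact: continuous_segment_integrable.
apply: (@lt_le_trans _ _ (\int[mu]_(x in `[p, q]) (f x0 / 2))).
  by rewrite Rintegral_segment_cst ?(ltW pq)// mulr_gt0// ?divr_gt0// subr_gt0.
apply: le_Rintegral => //; [|exact: continuous_segment_integrable|].
  by apply: continuous_segment_integrable => ?; exact: cvg_cst.
move=> x /=; rewrite in_itv/= /p /q ge_max le_min => xpq.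
have xd : `|x0 - x| < d by rewrite ltr_norml; lra.
by have := fd x xd; rewrite ltr_norml; lra.
Qed.

(** * Tents and their integrals *)

Definition tent r c x := Num.max 0 (r ^+ 2 - (x - c) ^+ 2).

Lemma tent_ge0 r c x : 0 <= tent r c x.
Proof. by rewrite le_max lexx. Qed.

Lemma tentE r c x : 0 <= r ->
  tent r c x = if x \in `[c - r, c + r] then r ^+ 2 - (x - c) ^+ 2 else 0.
Proof.
move=> r0; rewrite /tent in_itv/= -ler_distl.
have -> : (`|x - c| <= r) = ((x - c) ^+ 2 <= r ^+ 2).
  by rewrite -[in RHS]real_normK ?num_real// ler_sqr ?nnegrE.
by case: leP => h; [rewrite max_r|rewrite max_l]; lra.
Qed.

Lemma continuous_sqr_dist c : continuous (fun x => (x - c) ^+ 2).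
Proof.
move=> x; apply: (@continuous_comp _ _ _ (fun x => x - c) (fun x => x ^+ 2)).
  by apply: cvgB; [exact: cvg_id|exact: cvg_cst].
exact: exprn_continuous.
Qed.

Lemma continuous_tent r c : continuous (tent r c).
Proof.
rewrite (_ : tent r c = cst 0 \max (fun x => r ^+ 2 - (x - c) ^+ 2)) //.
apply: max_fun_continuous => x; first exact: cvg_cst.
by apply: cvgB; [exact: cvg_cst|exact: continuous_sqr_dist].
Qed.

Lemma Rintegral_cap p q r c : p < q ->
  \int[mu]_(x in `[p, q]) (r ^+ 2 - (x - c) ^+ 2) =
  r ^+ 2 * (q - p) - ((q - c) ^+ 3 - (p - c) ^+ 3) / 3.
Proof.
move=> pq; pose F x : R := r ^+ 2 * x - (x - c) ^+ 3 / 3.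
have dF x : is_derive x 1 F (r ^+ 2 - (x - c) ^+ 2).
  rewrite /F; apply: is_derive_eq; rewrite !scaler1 /GRing.scale/=.
  by field.
have cF : continuous F.
  by move=> x; apply/differentiable_continuous/derivable1_diffP; case: (dF x).
rewrite /Rintegral (@continuous_FTC2 _ _ F)//.
- by rewrite /F/=; field.
- apply: continuous_subspaceT => x.
  by apply: cvgB; [exact: cvg_cst|exact: continuous_sqr_dist].
- split; first by move=> x _; case: (dF x).
  + by apply: cvg_at_right_filter; exact: cF.
  + by apply: cvg_at_left_filter; exact: cF.
- by move=> x _; rewrite derive1E; case: (dF x).
Qed.

Lemma Rintegral_tent a b r c : 0 <= r ->
  \int[mu]_(x in `[a, b]) tent r c x =
  \int[mu]_(x in `[a, b] `&` `[c - r, c + r]) (r ^+ 2 - (x - c) ^+ 2).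
Proof.
move=> r0; rewrite Rintegral_mkcondr.
by apply: eq_Rintegral => x _; rewrite tentE// patchE mem_setE.
Qed.

Lemma Rintegral_tent_eq a b r c p q : 0 <= r -> p < q ->
  `[a, b] `&` `[c - r, c + r] = `[p, q]%classic ->
  \int[mu]_(x in `[a, b]) tent r c x =
  r ^+ 2 * (q - p) - ((q - c) ^+ 3 - (p - c) ^+ 3) / 3.
Proof. by move=> r0 pq E; rewrite -Rintegral_cap// -E Rintegral_tent. Qed.

(** The cap is nonnegative on [[c - r, c + r]], where its full integral is [4 / 3 * r ^+ 3]; cutting
    down to [[a, b]] can only lose mass. *)
Lemma Rintegral_tent_le a b r c : 0 < r ->
  \int[mu]_(x in `[a, b]) tent r c x <= 4 / 3 * r ^+ 3.
Proof.
move=> r0; rewrite Rintegral_tent ?(ltW r0)//.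
have -> : 4 / 3 * r ^+ 3 =
    \int[mu]_(x in `[c - r, c + r]) (r ^+ 2 - (x - c) ^+ 2).
  by rewrite Rintegral_cap ?ltrD2l ?gtrN//; field.
apply: ge0_subset_Rintegral => //.
- exact: measurableI.
- apply: continuous_segment_integrable => x.
  by apply: cvgB; [exact: cvg_cst|exact: continuous_sqr_dist].
- move=> x xc; rewrite -[leRHS](_ : tent r c x = _) ?tent_ge0//.
  by rewrite tentE ?(ltW r0)// ifT.
Qed.
End analysis.

(** * Centres whose balls of radius [r] tile a segment *)

Section tight_packing.
Context {R : realType}.
Implicit Types (a b c g r s x : R) (S : set R) (gamma : {fset R}).

(** The equality case of the pointwise bound. Over a whole segment it says that the closed balls of
    radius [r] around [S] cover the segment, while the open ones do not overlap there. *)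
Definition tight_at r S x :=
  (exists2 c, S c & `|x - c| <= r) /\
  (forall c d, S c -> S d -> `|x - c| < r -> `|x - d| < r -> c = d).

Definition tight r S a b := forall x, a <= x <= b -> tight_at r S x.

(** The next centre cannot come before [g + 2 * r], since open balls do not overlap, nor after it,
    since closed balls leave no hole. *)
Lemma tight_next r S a b g : 0 < r -> tight r S a b ->
  S g -> a <= g -> g + 2 * r <= b -> S (g + 2 * r).
Proof.
move=> r0 T Sg ag gb.
(* Otherwise the midpoint of [g] and [c] would be at distance less than [r] from both. *)
have gap c : S c -> g < c -> g + 2 * r <= c.
  move=> Sc gc; rewrite leNgt; apply/negP => cg.
  have [|_ U] := T ((g + c) / 2); first by lra.
  have : g = c by apply: U => //; rewrite ltr_norml; lra.
  by move=> gc'; rewrite gc' ltxx in gc.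
(* The offset [3 / 2 * r] puts the covering centre [c1] to the right of [g], hence beyond the gap,
   yet strictly within [r] of [g + 2 * r]. *)
have [|[c1 Sc1 xc1] _] := T (g + 3 / 2 * r); first by lra.
move: xc1; rewrite ler_norml => xc1.
have gc1 : g + 2 * r <= c1 by apply: gap => //; lra.
move: gc1; rewrite le_eqVlt => /predU1P[->//|gc1].
(* This is the midpoint of [g] and [c1]. If [c1] overshoots, it is farther than [r] from both, so a
   further centre [c2] covers it; then [c1] and [c2] are both strictly within [r] of [g + 2 * r]. *)
pose x2 := g + r + (c1 - (g + 2 * r)) / 2.
have [|[c2 Sc2 xc2] _] := T x2; first by rewrite /x2; lra.
move: xc2; rewrite ler_norml /x2 => xc2.
have gc2 : g + 2 * r <= c2 by apply: gap => //; lra.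
have [|_ U] := T (g + 2 * r); first by lra.
have c12 : c1 = c2 by apply: U => //; rewrite ltr_norml; lra.
by rewrite -c12 in xc2; lra.
Qed.

Lemma tight_up r S a b s (k : nat) : 0 < r -> tight r S a b ->
  S s -> a <= s -> s + 2 * r * k%:R <= b -> S (s + 2 * r * k%:R).
Proof.
move=> r0 T Ss as_; elim: k => [|k IH]; first by rewrite mulr0 addr0.
have k0 : 0 <= r * k%:R by rewrite mulr_ge0// ltW.
rewrite -natr1 => H.
rewrite (_ : s + _ = s + 2 * r * k%:R + 2 * r); last by ring.
by apply: (tight_next r0 T); [apply: IH; lra|lra|lra].
Qed.

(** Reflection in the origin, which turns propagation to the right into propagation to the left. *)
Lemma tightN r S a b :
  tight r S a b -> tight r [set x | S (- x)] (- b) (- a).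
Proof.
move=> T x xab; have [|[c Sc xc] U] := T (- x); first by lra.
split; first by exists (- c); rewrite /= ?opprK// -normrN opprD.
move=> c1 c2 /= S1 S2; rewrite -(normrN (x - c1)) -(normrN (x - c2)) => h1 h2.
by apply: oppr_inj; apply: U => //; rewrite -opprD.
Qed.

Lemma tight_down r S a b s (k : nat) : 0 < r -> tight r S a b ->
  S s -> s <= b -> a <= s - 2 * r * k%:R -> S (s - 2 * r * k%:R).
Proof.
move=> r0 /tightN T Ss sb ask.
have := @tight_up r _ _ _ (- s) k r0 T; rewrite /= opprK opprD opprK.
by apply=> //; lra.
Qed.

Definition grid s r (n : nat) : {fset R} :=
  [fset (s + 2 * r * k%:R)%R | k in iota 0 n]%fset.

Lemma gridP s r n c :
  reflect (exists2 k, (k < n)%N & c = s + 2 * r * k%:R) (c \in grid s r n).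
Proof.
apply: (iffP (imfsetP _ _ _ _)) => /= -[k kn ->]; exists k => //.
  by move: kn; rewrite mem_iota.
by rewrite mem_iota.
Qed.

Lemma card_grid s r n : 0 < r -> #|` grid s r n| = n.
Proof.
move=> r0; have r2 : 2 * r != 0 by rewrite mulf_neq0 ?pnatr_eq0// gt_eqF.
rewrite card_imfset/= ?undup_id ?iota_uniq ?size_iota//.
by move=> j k /addrI/(mulfI r2)/eqP; rewrite eqr_nat => /eqP.
Qed.

(** Closed balls around consecutive grid points just touch, so they tile everything from [r] before
    the first point to [r] after the last. *)
Lemma tight_grid s r n x : 0 < r -> (0 < n)%N ->
  s - r <= x <= s + 2 * r * (n%:R - 1) + r -> tight_at r [set` grid s r n] x.
Proof.
move=> r0 n0 xs; split.
  have : exists2 k, (k < n)%N & `|x - (s + 2 * r * k%:R)| <= r.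
    case: n n0 xs => // n _.
    rewrite (_ : n.+1%:R - 1 = n%:R); last by rewrite -natr1 addrK.
    elim: n => [|n IH] xs.
      by exists 0%N => //; rewrite ler_norml; lra.
    have [xn|xn] := leP x (s + 2 * r * n%:R + r).
      have [|k kn H] := IH; first by lra.
      by exists k => //; rewrite ltnW.
    exists n.+1 => //; move: xs; rewrite ler_norml -natr1; lra.
  by move=> [k kn H]; exists (s + 2 * r * k%:R) => //=; apply/gridP; exists k.
(* Two grid points strictly within [r] of [x] differ by less than [2 * r], whence [j < k + 1];
   exchanging the roles gives equality. *)
have sep (j k : nat) : `|x - (s + 2 * r * j%:R)| < r ->
    `|x - (s + 2 * r * k%:R)| < r -> (j <= k)%N.
  rewrite !ltr_norml => xj xk; rewrite -ltnS -(ltr_nat R) -natr1.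
  rewrite -(ltr_pM2l r0); lra.
move=> c d /= /gridP[j _ ->] /gridP[k _ ->] xj xk.
suff -> : j = k by [].
by apply/eqP; rewrite eqn_leq !sep.
Qed.

End tight_packing.

Section distortion.
Context {R : realType}.
Local Notation mu := (@lebesgue_measure R).
Implicit Types (a b c r x : R) (beta gamma : {fset R}) (n : nat).

(** Trades the extended-real minimum for comparisons of reals; it serves the squared distances of
    the distortion and the plain distances of the Voronoi regions alike. *)
Lemma fmin_eqP gamma (f : R -> R) c : c \in gamma ->
  (f c)%:E = fmin gamma f <-> (forall d, d \in gamma -> f c <= f d).
Proof.
move=> cg; split=> [E d dg|H].
  by rewrite -lee_fin E; exact: ge_bigmin_seq.
apply/eqP; rewrite eq_le ge_bigmin_seq// andbT /fmin big_seq.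
by apply: le_bigmin; rewrite ?leey// => d dg; rewrite lee_fin H.
Qed.

(* The distance of the base point [c0] serves as default value of the minimum;
   it is harmless because [c0] is always taken in [gamma]. *)
Definition sqdist c0 gamma x : R :=
  \big[Num.min/(x - c0) ^+ 2]_(c <- gamma) (x - c) ^+ 2.

Lemma sqdist_le c0 gamma c x : c \in gamma -> sqdist c0 gamma x <= (x - c) ^+ 2.
Proof. by move=> cg; apply: ge_bigmin_seq. Qed.

Lemma sqdist_attained c0 gamma x : c0 \in gamma ->
  exists2 c, c \in gamma & sqdist c0 gamma x = (x - c) ^+ 2.
Proof.
move=> c0g; rewrite /sqdist big_seq.
elim/big_ind: _ => [|u v [c cg ->] [d dg ->]|c cg].
- by exists c0.
- by rewrite /Num.min; case: ifP => _; [exists c|exists d].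
- by exists c.
Qed.

Lemma sqdist_ge0 c0 gamma x : c0 \in gamma -> 0 <= sqdist c0 gamma x.
Proof. by move=> /(sqdist_attained x)[c _ ->]; exact: sqr_ge0. Qed.

Lemma continuous_sqdist c0 gamma : continuous (sqdist c0 gamma).
Proof.
rewrite /sqdist; elim: (enum_fset gamma) => [|c s IH].
  under eq_fun do rewrite big_nil.
  exact: continuous_sqr_dist.
under eq_fun do rewrite big_cons.
apply: (@min_fun_continuous _ _ R (fun x => (x - c) ^+ 2)) => //.
exact: continuous_sqr_dist.
Qed.

Lemma fmin_sqdist c0 gamma x : c0 \in gamma ->
  fmin gamma (fun c => `|x - c| ^+ 2) = (sqdist c0 gamma x)%:E.
Proof.
move=> c0g; have [c cg E] := sqdist_attained x c0g.
rewrite E -(real_normK (num_real (x - c))); apply/esym.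
apply/(@fmin_eqP gamma (fun c => `|x - c| ^+ 2)) => // d dg.
by rewrite !real_normK ?num_real// -E sqdist_le.
Qed.

Lemma distortion_uniform a b (ab : a < b) c0 gamma : c0 \in gamma ->
  distortion (uniform_prob ab) gamma =
  ((b - a)^-1 * \int[mu]_(x in `[a, b]) sqdist c0 gamma x)%:E.
Proof.
move=> c0g; rewrite /distortion.
under eq_integral do rewrite (fmin_sqdist _ c0g).
have int_sqdist : mu.-integrable `[a, b] (EFin \o sqdist c0 gamma).
  exact/continuous_segment_integrable/continuous_sqdist.
rewrite integral_uniform.
- by rewrite -[X in (_ * X)%E]fineK ?EFinM//; exact: integrable_fin_num.
- apply/measurable_EFinP.
  by apply: continuous_measurable_fun; exact: continuous_sqdist.
- by move=> x; rewrite lee_fin sqdist_ge0.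
Qed.

(** The defect of the pointwise bound. Summing the tents of all points, not only of a nearest one,
    makes the integral a sum over [gamma] that does not involve the Voronoi regions. *)
Definition excess c0 r gamma x :=
  sqdist c0 gamma x - r ^+ 2 + \sum_(c <- gamma) tent r c x.

Lemma tent_eq0 r c x : 0 <= r -> (tent r c x == 0) = (r <= `|x - c|).
Proof.
move=> r0; rewrite /tent -ler_sqr ?nnegrE// real_normK ?num_real//.
rewrite -subr_le0; case: leP => h; rewrite ?eqxx//.
by apply/negbTE; rewrite gt_eqF.
Qed.

Lemma sqr_dist_tent_ge0 r c x : 0 <= (x - c) ^+ 2 - r ^+ 2 + tent r c x.
Proof.
have : r ^+ 2 - (x - c) ^+ 2 <= tent r c x by rewrite le_max lexx orbT.
by move=> h; lra.
Qed.

Lemma sqr_dist_tent_eq0 r c x : 0 <= r ->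
  ((x - c) ^+ 2 - r ^+ 2 + tent r c x == 0) = (`|x - c| <= r).
Proof.
move=> r0; rewrite -ler_sqr ?nnegrE// real_normK ?num_real// /tent.
case: (leP 0 (r ^+ 2 - (x - c) ^+ 2)) => h.
  by rewrite addrC subrKA subrr eqxx -subr_ge0 h.
rewrite addr0 gt_eqF; last by rewrite -opprB oppr_gt0.
by apply/esym/negbTE; rewrite -subr_ge0 -ltNge.
Qed.

Lemma excess_ge0 c0 r gamma x : c0 \in gamma -> 0 <= excess c0 r gamma x.
Proof.
move=> /(sqdist_attained x)[c cg E].
rewrite /excess E (big_fsetD1 c)//= addrA addr_ge0 ?sumr_ge0//.
  exact: sqr_dist_tent_ge0.
by move=> *; exact: tent_ge0.
Qed.

(** Once a nearest point [c] is split off, the excess is a sum of two nonnegative terms: that of [c]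
    vanishes iff [c] is within [r] of [x], the other tents vanish iff no other point is strictly
    within [r]. *)
Lemma excess_eq0P c0 r gamma x : 0 <= r -> c0 \in gamma ->
  excess c0 r gamma x = 0 <-> tight_at r [set` gamma] x.
Proof.
move=> r0 c0g; have [c cg E] := sqdist_attained x c0g.
have cmin d : d \in gamma -> `|x - c| <= `|x - d|.
  by move=> dg; rewrite -ler_sqr ?nnegrE// !real_normK ?num_real// -E sqdist_le.
rewrite /excess E (big_fsetD1 c)//= addrA; set s := \sum_(_ <- _) _.
have s0 : 0 <= s by apply: sumr_ge0 => *; exact: tent_ge0.
split=> [/eqP|[[c1 c1g xc1] U]].
  rewrite paddr_eq0 ?sqr_dist_tent_ge0// sqr_dist_tent_eq0//.
  rewrite /s big_seq psumr_eq0; last by move=> *; exact: tent_ge0.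
  move=> /andP[xc /allP tents].
  have uniq_c d : d \in gamma -> `|x - d| < r -> d = c.
    move=> dg xd; apply/eqP; apply: contraTT xd => dc; rewrite -leNgt.
    have dgc : d \in (gamma `\ c)%fset by rewrite !inE dc.
    by have := tents _ dgc; rewrite dgc/= tent_eq0.
  split; first by exists c.
  by move=> d e dg eg xd xe; rewrite (uniq_c d)// (uniq_c e).
have xc : `|x - c| <= r by rewrite (le_trans _ xc1)// cmin.
(* A point with a nonzero tent at [x] is strictly within [r], hence so is the nearest point [c], and
   uniqueness identifies the two. *)
have -> : s = 0.
  rewrite /s big_seq big1// => d; rewrite !inE => /andP[dc dg]; apply/eqP.
  rewrite tent_eq0// leNgt; apply: contraNN dc => xd; apply/eqP/U => //.
  exact: le_lt_trans (cmin _ dg) xd.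
by apply/eqP; rewrite addr0 sqr_dist_tent_eq0.
Qed.

Lemma continuous_sum_tent r gamma :
  continuous (fun x => \sum_(c <- gamma) tent r c x).
Proof. by apply: continuous_sumr => c; exact: continuous_tent. Qed.

Lemma continuous_excess c0 r gamma : continuous (excess c0 r gamma).
Proof.
move=> x; apply: cvgD; last exact: continuous_sum_tent.
by apply: cvgB; [exact: continuous_sqdist|exact: cvg_cst].
Qed.

Lemma Rintegral_excess a b c0 r gamma : a <= b ->
  \int[mu]_(x in `[a, b]) excess c0 r gamma x =
  \int[mu]_(x in `[a, b]) sqdist c0 gamma x - r ^+ 2 * (b - a) +
  \sum_(c <- gamma) \int[mu]_(x in `[a, b]) tent r c x.
Proof.
move=> ab; rewrite RintegralD//; last 2 first.
- apply: continuous_segment_integrable => x.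
  by apply: cvgB; [exact: continuous_sqdist|exact: cvg_cst].
- by apply: continuous_segment_integrable; exact: continuous_sum_tent.
rewrite RintegralB//; last 2 first.
- by apply: continuous_segment_integrable; exact: continuous_sqdist.
- by apply: continuous_segment_integrable => x; exact: cvg_cst.
rewrite Rintegral_segment_cst// Rintegral_segment_sum//.
by move=> c; exact: continuous_tent.
Qed.

(** The integral of the excess is nonnegative, so that of [sqdist] is at least [r ^+ 2 * (b - a)]
    minus the tent mass, which leaves one third of [r ^+ 2 * (b - a)]. *)
Lemma sqdist_lower_bound a b c0 r gamma : a < b -> 0 <= r -> c0 \in gamma ->
  \sum_(c <- gamma) \int[mu]_(x in `[a, b]) tent r c x <=
    2 / 3 * r ^+ 2 * (b - a) ->
  r ^+ 2 / 3 <= (b - a)^-1 * \int[mu]_(x in `[a, b]) sqdist c0 gamma x.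
Proof.
move=> ab r0 c0g tents; rewrite -ler_pdivrMl ?invr_gt0 ?subr_gt0// invrK.
have : 0 <= \int[mu]_(x in `[a, b]) excess c0 r gamma x.
  by apply: Rintegral_ge0 => x _; exact: excess_ge0.
rewrite Rintegral_excess ?(ltW ab)//; lra.
Qed.

(** Equality makes the integral of the excess at most 0; being continuous and nonnegative, the
    excess vanishes on the whole segment. *)
Lemma sqdist_tight a b c0 r gamma : a < b -> 0 <= r -> c0 \in gamma ->
  \sum_(c <- gamma) \int[mu]_(x in `[a, b]) tent r c x <=
    2 / 3 * r ^+ 2 * (b - a) ->
  (b - a)^-1 * \int[mu]_(x in `[a, b]) sqdist c0 gamma x = r ^+ 2 / 3 ->
  tight r [set` gamma] a b.
Proof.
move=> ab r0 c0g tents /(congr1 (fun z => (b - a) * z)).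
rewrite mulVKf ?gt_eqF ?subr_gt0// => E x xab; apply/(excess_eq0P x r0 c0g).
apply: (continuous_Rintegral0_eq0 ab (@continuous_excess c0 r gamma)).
- by move=> y _; exact: excess_ge0.
- by rewrite Rintegral_excess ?(ltW ab)// E; lra.
- by rewrite in_itv.
Qed.

Lemma tight_sqdist a b c0 r gamma : a < b -> 0 <= r -> c0 \in gamma ->
  \sum_(c <- gamma) \int[mu]_(x in `[a, b]) tent r c x =
    2 / 3 * r ^+ 2 * (b - a) ->
  tight r [set` gamma] a b ->
  (b - a)^-1 * \int[mu]_(x in `[a, b]) sqdist c0 gamma x = r ^+ 2 / 3.
Proof.
move=> ab r0 c0g tents T.
apply: (@mulfI _ (b - a)); first by rewrite gt_eqF// subr_gt0.
rewrite mulVKf ?gt_eqF ?subr_gt0//.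
have : \int[mu]_(x in `[a, b]) excess c0 r gamma x = 0.
  rewrite (@eq_Rintegral _ _ _ _ _ (cst 0)) ?Rintegral_cst ?mul0r// => x.
  by rewrite inE/= in_itv/= => xab; apply/excess_eq0P => //; exact: T.
rewrite Rintegral_excess ?(ltW ab)// tents; lra.
Qed.

(** The region is a finite intersection of sets comparing two continuous distances. Monotonicity of
    the measure will rely on this. *)
Lemma measurable_voronoi c gamma : c \in gamma ->
  measurable (voronoi c gamma : set (measurableTypeR R)).
Proof.
move=> cg.
have -> : voronoi c gamma =
    \bigcap_(d in [set` gamma]) [set x | `|x - c| <= `|x - d|].
  apply/seteqP; split=> x /=.
    by move/(@fmin_eqP _ (fun d => `|x - d|) _ cg).
  by move=> H; apply/(@fmin_eqP _ (fun d => `|x - d|) _ cg).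
apply: fin_bigcap_measurable => // d _.
rewrite -[X in measurable X]setTI.
have cd e : measurable_fun [set: measurableTypeR R] (fun x : R => `|x - e|).
  apply: continuous_measurable_fun => x; apply: cvg_norm.
  by apply: cvgB; [exact: cvg_id|exact: cvg_cst].
exact: (measurable_fun_ler (cd c) (cd d) measurableT (Y:=[set true])).
Qed.

(** Near the endpoint [c], tightness lets no other point of [gamma] come closer than [r], so the
    region of [c] contains a nondegenerate segment of [[a, b]]. *)
Lemma uniform_voronoi_gt0 a b (ab : a < b) r c gamma :
  0 < r -> c \in [fset a; b]%fset -> c \in gamma ->
  tight r [set` gamma] a b -> (0 < uniform_prob ab (voronoi c gamma))%E.
Proof.
move=> r0 cab cg T.
have [p [q [pq pa qb pqc]]] : exists p q, [/\ p < q, a <= p, q <= b &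
    forall x, p <= x <= q -> `|x - c| < r].
  (* The bound [r / 2] keeps the segment strictly within [r] of [c], and [b - a] keeps it inside
     [[a, b]]. *)
  pose d := Num.min (r / 2) (b - a).
  have [d0 dr dab] : [/\ 0 < d, d <= r / 2 & d <= b - a].
    by rewrite lt_min !ge_min !lexx orbT divr_gt0// subr_gt0.
  move: cab; rewrite !inE => /orP[] /eqP ->.
    by exists a, (a + d); split; [lra..|move=> x xp; rewrite ltr_norml; lra].
  by exists (b - d), b; split; [lra..|move=> x xp; rewrite ltr_norml; lra].
have pqv : `[p, q] `<=` voronoi c gamma.
  move=> x /=; rewrite in_itv/= => xpq.
  apply/(@fmin_eqP _ (fun d => `|x - d|) _ cg) => d dg.
  have xc := pqc x xpq; rewrite leNgt; apply/negP => dc.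
  have [|_ U] := T x; first by lra.
  by move: (dc); rewrite (U c d)// ?ltxx// (lt_trans dc).
have mv := measurable_voronoi cg.
apply: (@lt_le_trans _ _ (uniform_prob ab `[p, q])); last first.
  by apply: le_measure => //; rewrite inE.
rewrite /= /uniform_prob (eq_integral (fun=> (b - a)^-1%:E)); last first.
  move=> x; rewrite inE/= in_itv/= => xpq; rewrite /uniform_pdf ifT//; lra.
rewrite integral_cst//= lebesgue_measure_itv/= lte_fin pq -EFinD -EFinM lte_fin.
by rewrite mulr_gt0// ?invr_gt0 subr_gt0.
Qed.

(** Half of the tent falls outside the segment, and [r <= b - a] makes the other half fit
    entirely. *)
Lemma Rintegral_tent_endpoint a b r c : 0 < r -> r <= b - a ->
  c \in [fset a; b]%fset ->
  \int[mu]_(x in `[a, b]) tent r c x = 2 / 3 * r ^+ 3.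
Proof.
move=> r0 rab; rewrite !inE => /orP[] /eqP ->.
  rewrite (@Rintegral_tent_eq _ _ _ _ _ a (a + r)); [by field|lra|lra|].
  by apply/seteqP; split=> x /=; rewrite !in_itv/=; lra.
rewrite (@Rintegral_tent_eq _ _ _ _ _ (b - r) b); [by field|lra|lra|].
by apply/seteqP; split=> x /=; rewrite !in_itv/=; lra.
Qed.

Lemma Rintegral_tent_interior a b r c : 0 < r -> a + r <= c <= b - r ->
  \int[mu]_(x in `[a, b]) tent r c x = 4 / 3 * r ^+ 3.
Proof.
move=> r0 cab.
rewrite (@Rintegral_tent_eq _ _ _ _ _ (c - r) (c + r)); [by field|lra|lra|].
by apply/seteqP; split=> x /=; rewrite !in_itv/=; lra.
Qed.

Lemma sum_fset_if beta gamma (u v : R) : (beta `<=` gamma)%fset ->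
  \sum_(c <- gamma) (if c \in beta then u else v) =
  u * #|` beta|%:R + v * (#|` gamma|%:R - #|` beta|%:R).
Proof.
move=> bg; rewrite (big_fsetID _ (mem beta))/=.
have cst (A : {fset R}) (w : R) : \sum_(c <- A) w = w * #|` A|%:R.
  elim: (enum_fset A) => [|d s IH]; first by rewrite big_nil mulr0.
  by rewrite big_cons IH /= -natr1 mulrDr mulr1 addrC.
rewrite -natrB ?fsubset_leq_card// -(cardfsDS bg) -!cst; congr (_ + _).
  rewrite (_ : [fset _ in _ | _]%fset = beta); last first.
    by apply/fsetP => c; rewrite !inE/= andb_idl// => /(fsubsetP bg).
  by rewrite big_seq [RHS]big_seq; apply: eq_bigr => c ->.
rewrite (_ : [fset _ in _ | _]%fset = (gamma `\` beta)%fset); last first.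
  by apply/fsetP => c; rewrite !inE/= andbC.
rewrite big_seq [RHS]big_seq; apply: eq_bigr => c.
by rewrite inE => /andP[/negbTE ->].
Qed.

(** * The optimum for prescribed endpoints [beta], with [r] fixed by the number of points *)

Section conditional_optimum.
Variables (a b r : R) (n : nat) (beta : {fset R}) (c0 : R).
Hypotheses (ab : a < b) (r0 : 0 < r) (c0b : c0 \in beta).
Hypotheses (bab : (beta `<=` [fset a; b])%fset) (bn : (#|` beta| <= n)%N).
Hypothesis rE : r * (2 * n%:R - #|` beta|%:R) = b - a.

(** Since [beta] has between 1 and [n] points, the factor of [r] in [rE] is at least 1. *)
Let r_le : r <= b - a.
Proof.
have b1 : (0 < #|` beta|)%N by rewrite cardfs_gt0; apply/fset0Pn; exists c0.
have n1 : 1 <= n%:R :> R by rewrite ler1n (leq_trans b1).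
have nb : #|` beta|%:R <= n%:R :> R by rewrite ler_nat.
by rewrite -rE ler_peMr ?(ltW r0)//; lra.
Qed.

(** With [l] the size of [beta], prescribed endpoints carry half tents and the other points at most
    full ones, in total at most [2 / 3 * r ^+ 3 * (l + 2 * (n - l))]; the choice of [r] in [rE]
    turns this into the stated bound. *)
Lemma sum_tent_le gamma : (beta `<=` gamma)%fset -> (#|` gamma| <= n)%N ->
  \sum_(c <- gamma) \int[mu]_(x in `[a, b]) tent r c x <=
    2 / 3 * r ^+ 2 * (b - a).
Proof.
move=> bg gn.
apply: (@le_trans _ _ (\sum_(c <- gamma)
    (if c \in beta then 2 / 3 * r ^+ 3 else 4 / 3 * r ^+ 3))).
  apply: ler_sum => c _; case: ifP => [cb|_]; last exact: Rintegral_tent_le.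
  by rewrite Rintegral_tent_endpoint// (fsubsetP bab).
rewrite sum_fset_if// -rE.
have gnR : #|` gamma|%:R <= n%:R :> R by rewrite ler_nat.
have := ler_wpM2l (ltW (exprn_gt0 3 r0)) gnR; lra.
Qed.

(** The previous bound is attained when all [n] points are used and each point outside [beta] has
    its whole tent inside the segment. *)
Lemma sum_tent_eq gamma : (beta `<=` gamma)%fset -> #|` gamma| = n ->
  (forall c, c \in gamma -> c \notin beta -> a + r <= c <= b - r) ->
  \sum_(c <- gamma) \int[mu]_(x in `[a, b]) tent r c x =
    2 / 3 * r ^+ 2 * (b - a).
Proof.
move=> bg gn inner.
transitivity (\sum_(c <- gamma)
    (if c \in beta then 2 / 3 * r ^+ 3 else 4 / 3 * r ^+ 3)).
  rewrite big_seq [RHS]big_seq; apply: eq_bigr => c cg; case: ifPn => cb.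
    by rewrite Rintegral_tent_endpoint// (fsubsetP bab).
  by rewrite Rintegral_tent_interior// inner.
rewrite sum_fset_if// -rE gn; ring.
Qed.

(** The tight set [gamma0] attains the lower bound. Conversely an optimal set attains it too, hence
    is tight and contains [gamma0]; having at most [n] points, it cannot be larger. *)
Lemma cond_optimal_uniform (gamma0 : {fset R}) :
  (beta `<=` gamma0)%fset -> #|` gamma0| = n ->
  (forall c, c \in gamma0 -> c \notin beta -> a + r <= c <= b - r) ->
  tight r [set` gamma0] a b ->
  (forall gamma, (beta `<=` gamma)%fset -> tight r [set` gamma] a b ->
    (gamma0 `<=` gamma)%fset) ->
  (forall gamma, cond_optimal (uniform_prob ab) beta n gamma <->
     gamma = gamma0) /\
  cond_quant_error (uniform_prob ab) beta n = (r ^+ 2 / 3)%:E.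
Proof.
move=> bg0 g0n inner T0 min0.
have c0g gamma : (beta `<=` gamma)%fset -> c0 \in gamma.
  by move=> /fsubsetP; apply.
have D0 : distortion (uniform_prob ab) gamma0 = (r ^+ 2 / 3)%:E.
  rewrite (distortion_uniform ab (c0g _ bg0)); congr _%:E.
  apply: (tight_sqdist ab (ltW r0) (c0g _ bg0)) => //; exact: sum_tent_eq.
(* By [bn] the truncated difference is exact, so adding the size of [beta] back gives [n]. *)
have card_le alpha : (#|` alpha| <= n - #|` beta|)%N ->
    (#|` (alpha `|` beta)%fset| <= n)%N.
  move=> an; rewrite cardfsU (leq_trans (leq_subr _ _))//.
  by rewrite -(subnK bn) leq_add2r.
have g0E : gamma0 = ((gamma0 `\` beta) `|` beta)%fset.
  apply/fsetP => c; rewrite !inE; case: (boolP (c \in beta)) => [cb|_].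
    by rewrite (fsubsetP bg0 c cb).
  by rewrite orbF.
have cardD : (#|` (gamma0 `\` beta)%fset| <= n - #|` beta|)%N.
  by rewrite cardfsDS// g0n.
have V : cond_quant_error (uniform_prob ab) beta n = (r ^+ 2 / 3)%:E.
  apply/eqP; rewrite eq_le; apply/andP; split.
    apply: ereal_inf_lbound; exists (gamma0 `\` beta)%fset => //.
    by rewrite -g0E.
  apply/ereal_infP => _ [alpha /= an <-].
  have bU : (beta `<=` alpha `|` beta)%fset by exact: fsubsetUr.
  rewrite (distortion_uniform ab (c0g _ bU)) lee_fin.
  by apply: sqdist_lower_bound; rewrite ?(ltW r0) ?c0g ?sum_tent_le ?card_le.
split=> // gamma; split=> [[alpha [[an gE] D _ /andP[_ gn]]]|->].
  have bg : (beta `<=` gamma)%fset by rewrite gE; exact: fsubsetUr.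
  have g0g : (gamma0 `<=` gamma)%fset.
    apply: min0 => //; apply: (sqdist_tight ab (ltW r0) (c0g _ bg)).
      exact: sum_tent_le.
    by apply: EFin_inj; rewrite -distortion_uniform ?c0g// D.
  apply/eqP; rewrite eq_sym -(geq_leqif (fsubset_leqif_cards g0g)).
  by rewrite g0n.
exists (gamma0 `\` beta)%fset; split=> //; [by rewrite D0| |].
- move=> c cb; apply: (uniform_voronoi_gt0 ab r0) => //.
    exact: (fsubsetP bab).
  exact: (fsubsetP bg0).
- by rewrite g0n bn leqnn.
Qed.

End conditional_optimum.

End distortion.

(** Reconciles indices running from 1 to [n] with the grid, which counts from 0. *)
Lemma imfset_grid (R : realType) (s r : R) (n : nat) (f : nat -> R) :
  (forall k, f k.+1 = s + 2 * r * k%:R) ->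
  [fset f j | j in index_iota 1 n.+1]%fset = grid s r n.
Proof.
move=> fE; apply/fsetP => c; apply/idP/idP => [/imfsetP[/= j]|/gridP[k kn ->]].
  rewrite mem_index_iota; case: j => // k /andP[_ kn] ->.
  by apply/gridP; exists k; rewrite ?fE.
by apply/imfsetP; exists k.+1; rewrite /= ?fE// mem_index_iota.
Qed.

(** * The three conditional sets, each with its own grid *)

Theorem theorem3p1 (R : realType) (a b : R) (ab : a < b) :
  [/\ forall n : nat, (2 <= n)%N ->
        (forall gamma : {fset R},
           cond_optimal (uniform_prob ab) [fset a; b]%fset n gamma <->
           gamma = [fset (a + (j%:R - 1) / (n%:R - 1) * (b - a))%R
                     | j in index_iota 1 n.+1]%fset) /\
        cond_quant_error (uniform_prob ab) [fset a; b]%fset n =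
          ((b - a) ^+ 2 / (12 * (n%:R - 1) ^+ 2))%:E,
      forall n : nat, (1 <= n)%N ->
        (forall gamma : {fset R},
           cond_optimal (uniform_prob ab) [fset a]%fset n gamma <->
           gamma = [fset (a + 2 * (j%:R - 1) * (b - a) / (2 * n%:R - 1))%R
                     | j in index_iota 1 n.+1]%fset) /\
        cond_quant_error (uniform_prob ab) [fset a]%fset n =
          ((b - a) ^+ 2 / (3 * (2 * n%:R - 1) ^+ 2))%:E
    & forall n : nat, (1 <= n)%N ->
        (forall gamma : {fset R},
           cond_optimal (uniform_prob ab) [fset b]%fset n gamma <->
           gamma = [fset (a + (2 * j%:R - 1) * (b - a) / (2 * n%:R - 1))%R
                     | j in index_iota 1 n.+1]%fset) /\
        cond_quant_error (uniform_prob ab) [fset b]%fset n =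
          ((b - a) ^+ 2 / (3 * (2 * n%:R - 1) ^+ 2))%:E].
Proof.
have ba : 0 < b - a by rewrite subr_gt0.
split=> n n1.
- have nR : 2 <= n%:R :> R by rewrite ler_nat.
  (* Here [beta] has 2 points, so the factor in [rE] is [2 * n - 2], and the grid starting at [a]
     ends exactly at [b]. *)
  pose r := (b - a) / (2 * (n%:R - 1)).
  have r0 : 0 < r by rewrite divr_gt0//; lra.
  have rn : 2 * r * (n%:R - 1) = b - a by rewrite /r; field; lra.
  have ab2 : #|` [fset a; b]%fset| = 2%N by rewrite cardfs2 lt_eqF.
  have -> : [fset (a + (j%:R - 1) / (n%:R - 1) * (b - a))%R
      | j in index_iota 1 n.+1]%fset = grid a r n.
    by apply: imfset_grid => k; rewrite -[k.+1%:R]natr1 addrK /r; field; lra.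
  have -> : (b - a) ^+ 2 / (12 * (n%:R - 1) ^+ 2) = r ^+ 2 / 3.
    by rewrite /r; field; lra.
  have a_grid : a \in grid a r n.
    by apply/gridP; exists 0%N; [exact: leq_trans n1|rewrite mulr0 addr0].
  have b_grid : b \in grid a r n.
    apply/gridP; exists n.-1; first by rewrite prednK// (leq_trans _ n1).
    by rewrite -subn1 natrB ?(leq_trans _ n1)// rn; ring.
  apply: (@cond_optimal_uniform R a b r n _ a) => //.
  + by rewrite !inE eqxx.
  + by rewrite ab2.
  + by rewrite ab2 -rn; ring.
  + by apply/fsubsetP => c; rewrite !inE => /orP[]/eqP ->.
  + exact: card_grid.
  + move=> _ /gridP[k kn ->]; rewrite !inE negb_or => /andP[ka kb].
    have k0 : (0 < k)%N.
      by case: k ka {kn kb} => //; rewrite mulr0 addr0 eqxx.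
    (* The index [n - 1] would give the endpoint [b], so [k] is at most [n - 2]. *)
    have kn1 : (k.+2 <= n)%N.
      rewrite ltn_neqAle kn andbT; apply: contraNneq kb => kn1; apply/eqP.
      by move: rn; rewrite -[in n%:R]kn1 -[k.+1%:R]natr1; lra.
    have k1R : 1 <= k%:R :> R by rewrite ler1n.
    have knR : k%:R + 2 <= n%:R :> R by rewrite -natrD ler_nat addn2.
    have := ler_wpM2l (ltW r0) k1R; have := ler_wpM2l (ltW r0) knR; lra.
  + by move=> x xab; apply: tight_grid; rewrite ?(leq_trans _ n1)//; lra.
  + move=> gamma bg T; apply/fsubsetP => _ /gridP[k kn ->].
    apply: (@tight_up _ r [set` gamma] a b) => //=.
      by apply: (fsubsetP bg); rewrite !inE eqxx.
    have knR : k%:R + 1 <= n%:R :> R by rewrite natr1 ler_nat.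
    have := ler_wpM2l (ltW r0) knR; lra.
- have nR : 1 <= n%:R :> R by rewrite ler1n.
  (* With a single prescribed point the factor is [2 * n - 1]: the grid starting at [a] ends at
     [b - r], where the last tent just reaches [b]. *)
  pose r := (b - a) / (2 * n%:R - 1).
  have r0 : 0 < r by rewrite divr_gt0//; lra.
  have rn : r * (2 * n%:R - 1) = b - a by rewrite /r; field; lra.
  have -> : [fset (a + 2 * (j%:R - 1) * (b - a) / (2 * n%:R - 1))%R
      | j in index_iota 1 n.+1]%fset = grid a r n.
    by apply: imfset_grid => k; rewrite -[k.+1%:R]natr1 addrK /r; field; lra.
  have -> : (b - a) ^+ 2 / (3 * (2 * n%:R - 1) ^+ 2) = r ^+ 2 / 3.
    by rewrite /r; field; lra.
  apply: (@cond_optimal_uniform R a b r n _ a) => //.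
  + by rewrite !inE.
  + by apply/fsubsetP => c; rewrite !inE => ->.
  + by rewrite cardfs1.
  + by rewrite cardfs1.
  + apply/fsubsetP => c; rewrite !inE => /eqP ->.
    by apply/gridP; exists 0%N; rewrite ?mulr0 ?addr0.
  + exact: card_grid.
  + move=> _ /gridP[k kn ->]; rewrite !inE => ka.
    have k0 : (0 < k)%N by case: k ka {kn} => //; rewrite mulr0 addr0 eqxx.
    have k1R : 1 <= k%:R :> R by rewrite ler1n.
    have knR : k%:R + 1 <= n%:R :> R by rewrite natr1 ler_nat.
    have := ler_wpM2l (ltW r0) k1R; have := ler_wpM2l (ltW r0) knR; lra.
  + by move=> x xab; apply: tight_grid; rewrite ?n1//; lra.
  + move=> gamma bg T; apply/fsubsetP => _ /gridP[k kn ->].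
    apply: (@tight_up _ r [set` gamma] a b) => //=.
      by apply: (fsubsetP bg); rewrite !inE.
    have knR : k%:R + 1 <= n%:R :> R by rewrite natr1 ler_nat.
    have := ler_wpM2l (ltW r0) knR; lra.
- have nR : 1 <= n%:R :> R by rewrite ler1n.
  (* The same mesh, mirrored: the grid now starts at [a + r], so that its last point is [b]. *)
  pose r := (b - a) / (2 * n%:R - 1).
  have r0 : 0 < r by rewrite divr_gt0//; lra.
  have rn : r * (2 * n%:R - 1) = b - a by rewrite /r; field; lra.
  have -> : [fset (a + (2 * j%:R - 1) * (b - a) / (2 * n%:R - 1))%R
      | j in index_iota 1 n.+1]%fset = grid (a + r) r n.
    by apply: imfset_grid => k; rewrite -[k.+1%:R]natr1 /r; field; lra.
  have -> : (b - a) ^+ 2 / (3 * (2 * n%:R - 1) ^+ 2) = r ^+ 2 / 3.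
    by rewrite /r; field; lra.
  apply: (@cond_optimal_uniform R a b r n _ b) => //.
  + by rewrite !inE.
  + by apply/fsubsetP => c; rewrite !inE => ->; rewrite orbT.
  + by rewrite cardfs1.
  + by rewrite cardfs1.
  + apply/fsubsetP => c; rewrite !inE => /eqP ->.
    apply/gridP; exists n.-1; first by rewrite prednK.
    by rewrite -subn1 natrB//; lra.
  + exact: card_grid.
  + move=> _ /gridP[k kn ->]; rewrite !inE => kb.
    have kn1 : (k.+2 <= n)%N.
      rewrite ltn_neqAle kn andbT; apply: contraNneq kb => kn1; apply/eqP.
      by move: rn; rewrite -[in n%:R]kn1 -[k.+1%:R]natr1; lra.
    have knR : k%:R + 2 <= n%:R :> R by rewrite -natrD ler_nat addn2.
    have := mulr_ge0 (ltW r0) (ler0n R k).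
    have := ler_wpM2l (ltW r0) knR; lra.
  + by move=> x xab; apply: tight_grid; rewrite ?n1//; lra.
  + move=> gamma bg T; apply/fsubsetP => _ /gridP[k kn ->].
    have knR : k%:R + 1 <= n%:R :> R by rewrite natr1 ler_nat.
    (* Propagation has to start from the known point [b], so the grid is counted from the right;
       [k < n] makes the truncated subtraction exact. *)
    have nkE : (n.-1 - k)%:R = n%:R - 1 - k%:R :> R.
      by rewrite -subn1 natrB ?natrB// -ltnS subn1 prednK.
    have -> : a + r + 2 * r * k%:R = b - 2 * r * (n.-1 - k)%:R.
      by rewrite nkE; lra.
    apply: (@tight_down _ r [set` gamma] a b) => //=.
      by apply: (fsubsetP bg); rewrite !inE.
    rewrite nkE; have := mulr_ge0 (ltW r0) (ler0n R k); lra.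
Qed.
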